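(* Let $k$ be an algebraically closed field of characteristic $2$. Let $G=SL_3\rtimes\langle\sigma\rangle$ be defined over $k$, where $\sigma$ is a non-trivial graph automorphism of $SL_3$. Then there exists a (non-connected) reductive subgroup $M$ of $G$ and a pair $(m_1,m_2)\in M^2$ such that $G\cdot(m_1,m_2)\cap M^2$ is an infinite union of $M$-conjugacy classes.
   Context: A (possibly non-connected) affine algebraic group is reductive if its unipotent radical is trivial. $G$ acts on $G^2$ by simultaneous conjugation, $g\cdot(m_1,m_2)=(gm_1g^{-1},gm_2g^{-1})$, and $M$-conjugacy classes in $M^2$ are the orbits of $M$ on $M^2$ under simultaneous conjugation. *)

(* Defs.v *)
From HB Require Import structures.
From mathcomp Require Import all_boot all_order all_fingroup all_algebra.
From mathcomp Require Import mpoly ring.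
From mathcomp Require Import classical_sets functions cardinality.

Set Implicit Arguments.
Unset Strict Implicit.
Unset Printing Implicit Defensive.

Import GRing.Theory.
Local Open Scope classical_set_scope.
Local Open Scope ring_scope.

Section AlgebraicGroup.
(* [G] is the group of [k]-points of an affine algebraic group over the
   algebraically closed field [k], and [kG] is its coordinate ring, seen as a
   set of functions on points.  Algebraic subgroups are closed subgroups. *)
Variables (k : closedFieldType) (G : groupType) (kG : set (G -> k)).
Implicit Types (M N S A B : set G) (x y : G).

Definition zclosed S : Prop :=
  exists2 I : set (G -> k), I `<=` kG & S = [set x | forall f, I f -> f x = 0].

Definition zconnected S : Prop := forall A B, zclosed A -> zclosed B ->
  S `<=` A `|` B -> S `&` A `&` B = set0 -> S `<=` A \/ S `<=` B.

Definition subgroup S : Prop :=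
  [/\ S 1%g, forall x y, S x -> S y -> S (x * y)%g
    & forall x, S x -> S (x^-1)%g].

Definition closed_subgroup S : Prop := subgroup S /\ zclosed S.

Definition normal_in N M : Prop :=
  N `<=` M /\ forall x y, N x -> M y -> N (x ^ y)%g.

Definition rtrans x (f : G -> k) : G -> k := fun y => f (y * x)%g.

(* x is unipotent iff right translation by x is a locally unipotent
   endomorphism of the coordinate ring. *)
Definition unipotent x : Prop := forall f, kG f ->
  exists n : nat,
    iter n (fun (h : G -> k) y => rtrans x h y - h y) f = (fun=> 0).

(* The closed connected normal unipotent subgroups of an algebraic group M have
   a largest element, so their union is the unipotent radical. *)
Definition unipotent_radical M : set G :=
  [set x | exists U, [/\ closed_subgroup U, zconnected U, normal_in U M,
                         U `<=` unipotent & U x]].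

Definition reductive M : Prop :=
  closed_subgroup M /\ unipotent_radical M = [set 1%g].

End AlgebraicGroup.

Section SimultaneousConjugation.
Variable G : groupType.

Definition sconj (g : G) (m : G * G) : G * G :=
  ((g * m.1 * g^-1)%g, (g * m.2 * g^-1)%g).

Definition sconj_orbit (H : set G) (m : G * G) : set (G * G) :=
  [set sconj g m | g in H].

End SimultaneousConjugation.

Section SpecialLinear.
Variables (k : fieldType) (n : nat).

Record SL := MkSL { sl_mx :> 'M[k]_n; _ : \det sl_mx == 1 }.

HB.instance Definition _ := [isSub for sl_mx].
HB.instance Definition _ := [Choice of SL by <:].

Implicit Types A B : SL.

Lemma sl_det A : \det A = 1. Proof. by case: A => B /= /eqP. Qed.

Lemma sl_unit A : (A : 'M_n) \in unitmx.
Proof. by rewrite unitmxE sl_det unitr1. Qed.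

Fact sl_one_subproof : \det (1%:M : 'M[k]_n) == 1. Proof. by rewrite det1. Qed.
Fact sl_mul_subproof A B : \det (A *m B) == 1.
Proof. by rewrite det_mulmx !sl_det mulr1. Qed.
Fact sl_inv_subproof A : \det (invmx A) == 1.
Proof. by rewrite det_inv sl_det invr1. Qed.

Definition sl_one := MkSL sl_one_subproof.
Definition sl_mul A B := MkSL (sl_mul_subproof A B).
Definition sl_inv A := MkSL (sl_inv_subproof A).

Fact sl_mulA : associative sl_mul.
Proof. by move=> A B C; apply: val_inj; rewrite /= mulmxA. Qed.
Fact sl_mul1 : left_id sl_one sl_mul.
Proof. by move=> A; apply: val_inj; rewrite /= mul1mx. Qed.
Fact sl_1mul : right_id sl_one sl_mul.
Proof. by move=> A; apply: val_inj; rewrite /= mulmx1. Qed.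
Fact sl_mulV : left_inverse sl_one sl_inv sl_mul.
Proof. by move=> A; apply: val_inj; rewrite /= mulVmx ?sl_unit. Qed.
Fact sl_Vmul : right_inverse sl_one sl_inv sl_mul.
Proof. by move=> A; apply: val_inj; rewrite /= mulmxV ?sl_unit. Qed.

HB.instance Definition _ :=
  isGroup.Build SL sl_mulA sl_mul1 sl_1mul sl_mulV sl_Vmul.

End SpecialLinear.

Section GraphAutomorphism.
Variable k : fieldType.

(* Simple root elements and their opposites for the diagonal torus and the
   upper triangular Borel subgroup; the simple roots are indexed by 'I_2, and
   the two lifts have values i and i.+1. *)
Definition xroot (i : 'I_2) (t : k) : 'M[k]_3 :=
  1%:M + t *: delta_mx (lift ord_max i) (lift ord0 i).
Definition yroot (i : 'I_2) (t : k) : 'M[k]_3 :=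
  1%:M + t *: delta_mx (lift ord0 i) (lift ord_max i).

(* Graph automorphisms in the sense of Steinberg and Carter: for some pinning
   (they are all GL_3-conjugate to the standard one, whence h), they send
   x_a(t) to x_(rho a)(t) for every simple root a and every opposite of one,
   rho being a symmetry of the Dynkin diagram.  In type A2 every permutation of
   the two nodes is a symmetry.  As root elements generate SL_3, this makes
   sigma an automorphism of algebraic groups. *)
Record graph_aut := GraphAut {
  gaut :> SL k 3 -> SL k 3;
  gautM : {morph gaut : A B / (A * B)%g};
  gaut_bij : bijective gaut;
  gaut_pinned : exists (h : 'M[k]_3) (rho : {perm 'I_2}), h \in unitmx /\
    forall (i : 'I_2) (t : k) (A : SL k 3),
      (A = h *m xroot i t *m invmx h :> 'M_3 ->
         gaut A = h *m xroot (rho i) t *m invmx h :> 'M_3) /\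
      (A = h *m yroot i t *m invmx h :> 'M_3 ->
         gaut A = h *m yroot (rho i) t *m invmx h :> 'M_3)
}.

Definition mk3 (a b c d e f g h i : k) : 'M[k]_3 :=
  \matrix_(r, s) nth 0 (nth [::] [:: [:: a; b; c]; [:: d; e; f]; [:: g; h; i]] r) s.

Lemma mk3E (A : 'M[k]_3) : exists a b c d e f g h i, A = mk3 a b c d e f g h i.
Proof.
exists (A 0 0), (A 0 1), (A 0 (inord 2)), (A 1 0), (A 1 1), (A 1 (inord 2)),
  (A (inord 2) 0), (A (inord 2) 1), (A (inord 2) (inord 2)).
apply/matrixP => -[[|[|[|//]]] ?] [[|[|[|//]]] ?]; rewrite mxE /=;
  congr (A _ _); apply/val_inj; rewrite /= ?inordK //.
Qed.

Lemma det_mk3 a b c d e f g h i :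
  \det (mk3 a b c d e f g h i)
  = a * (e * i - f * h) - b * (d * i - f * g) + c * (d * h - e * g).
Proof.
rewrite (expand_det_row _ 0) !big_ord_recl big_ord0 /cofactor.
rewrite !(expand_det_row _ (0 : 'I_2)) !big_ord_recl !big_ord0 /cofactor.
by rewrite !det_mx11 !mxE /= /bump /=; ring.
Qed.

Lemma mul_mk3 a b c d e f g h i a' b' c' d' e' f' g' h' i' :
  mk3 a b c d e f g h i *m mk3 a' b' c' d' e' f' g' h' i' =
  mk3 (a*a'+b*d'+c*g') (a*b'+b*e'+c*h') (a*c'+b*f'+c*i')
      (d*a'+e*d'+f*g') (d*b'+e*e'+f*h') (d*c'+e*f'+f*i')
      (g*a'+h*d'+i*g') (g*b'+h*e'+i*h') (g*c'+h*f'+i*i').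
Proof.
by apply/matrixP => -[[|[|[|//]]] ?] [[|[|[|//]]] ?];
  rewrite mxE !big_ord_recl big_ord0 !mxE /=; ring.
Qed.

Lemma mk3_1 : 1%:M = mk3 1 0 0 0 1 0 0 0 1.
Proof. by apply/matrixP => -[[|[|[|//]]] ?] [[|[|[|//]]] ?]; rewrite !mxE. Qed.

Lemma root_mk3 t :
  [/\ xroot 0 t = mk3 1 t 0 0 1 0 0 0 1, xroot 1 t = mk3 1 0 0 0 1 t 0 0 1,
      yroot 0 t = mk3 1 0 0 t 1 0 0 0 1 & yroot 1 t = mk3 1 0 0 0 1 0 0 t 1].
Proof.
by split; apply/matrixP => -[[|[|[|//]]] ?] [[|[|[|//]]] ?];
  rewrite !mxE /=; ring.
Qed.

Lemma SL3_root_ind (P : 'M[k]_3 -> Prop) :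
  (forall A B, P A -> P B -> P (A *m B)) ->
  (forall i t, P (xroot i t)) -> (forall i t, P (yroot i t)) ->
  forall A : 'M[k]_3, \det A = 1 -> P A.
Proof.
move=> PM Px Py.
have P01 t : P (mk3 1 t 0 0 1 0 0 0 1) by case: (root_mk3 t) => <-.
have P12 t : P (mk3 1 0 0 0 1 t 0 0 1) by case: (root_mk3 t) => _ <-.
have P10 t : P (mk3 1 0 0 t 1 0 0 0 1) by case: (root_mk3 t) => _ _ <-.
have P21 t : P (mk3 1 0 0 0 1 0 0 t 1) by case: (root_mk3 t) => _ _ _ <-.
have P02 t : P (mk3 1 0 t 0 1 0 0 0 1).
  have := PM _ _ (PM _ _ (P01 t) (P12 1)) (PM _ _ (P01 (- t)) (P12 (- 1))).
  by rewrite !mul_mk3; congr (P (mk3 _ _ _ _ _ _ _ _ _)); ring.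
have P20 t : P (mk3 1 0 0 0 1 0 t 0 1).
  have := PM _ _ (PM _ _ (P21 t) (P10 1)) (PM _ _ (P21 (- t)) (P10 (- 1))).
  by rewrite !mul_mk3; congr (P (mk3 _ _ _ _ _ _ _ _ _)); ring.
have row01 t a b c d e f g h i :
  P (mk3 (a+t*d) (b+t*e) (c+t*f) d e f g h i) -> P (mk3 a b c d e f g h i).
  move/(PM _ _ (P01 (-t))); rewrite mul_mk3.
  by congr (P (mk3 _ _ _ _ _ _ _ _ _)); ring.
have row02 t a b c d e f g h i :
  P (mk3 (a+t*g) (b+t*h) (c+t*i) d e f g h i) -> P (mk3 a b c d e f g h i).
  move/(PM _ _ (P02 (-t))); rewrite mul_mk3.
  by congr (P (mk3 _ _ _ _ _ _ _ _ _)); ring.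
have row12 t a b c d e f g h i :
  P (mk3 a b c (d+t*g) (e+t*h) (f+t*i) g h i) -> P (mk3 a b c d e f g h i).
  move/(PM _ _ (P12 (-t))); rewrite mul_mk3.
  by congr (P (mk3 _ _ _ _ _ _ _ _ _)); ring.
have row10 t a b c d e f g h i :
  P (mk3 a b c (d+t*a) (e+t*b) (f+t*c) g h i) -> P (mk3 a b c d e f g h i).
  move/(PM _ _ (P10 (-t))); rewrite mul_mk3.
  by congr (P (mk3 _ _ _ _ _ _ _ _ _)); ring.
have row20 t a b c d e f g h i :
  P (mk3 a b c d e f (g+t*a) (h+t*b) (i+t*c)) -> P (mk3 a b c d e f g h i).
  move/(PM _ _ (P20 (-t))); rewrite mul_mk3.
  by congr (P (mk3 _ _ _ _ _ _ _ _ _)); ring.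
have row21 t a b c d e f g h i :
  P (mk3 a b c d e f (g+t*d) (h+t*e) (i+t*f)) -> P (mk3 a b c d e f g h i).
  move/(PM _ _ (P21 (-t))); rewrite mul_mk3.
  by congr (P (mk3 _ _ _ _ _ _ _ _ _)); ring.
have red3 b c f i : i = 1 -> P (mk3 1 b c 0 1 f 0 0 i).
  move=> ->; apply: (row12 (- f)); apply: (row02 (- c)); apply: (row01 (- b)).
  by have := P01 0; congr (P (mk3 _ _ _ _ _ _ _ _ _)); ring.
have red2 b c f h i : i - f * h = 1 -> P (mk3 1 b c 0 1 f 0 h i).
  move=> D; apply: (row21 (- h)).
  have := @red3 b c f (i - f * h) D.
  by congr (P (mk3 _ _ _ _ _ _ _ _ _)); ring.
have red2' b c e f h i : h != 0 -> e * i - f * h = 1 -> P (mk3 1 b c 0 e f 0 h i).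
  move=> h0 D; apply: (row12 ((1 - e) / h)).
  have := @red2 b c (f + (1 - e) / h * i) h i.
  have -> : e + (1 - e) / h * h = 1 by rewrite mulfVK //; ring.
  rewrite mulr0 addr0; apply.
  have -> : i - (f + (1 - e) / h * i) * h =
    i - f * h - (1 - e) / h * h * i by ring.
  by rewrite mulfVK // -[RHS]D; ring.
have red1 b c e f h i : e * i - f * h = 1 -> P (mk3 1 b c 0 e f 0 h i).
  have [->|h0 D] := eqVneq h 0; last exact: red2'.
  move=> D; apply: (row21 1); rewrite !mulr0 !addr0 !mul1r add0r.
  apply: red2'; last by rewrite -[RHS]D; ring.
  by apply/eqP => e0; move/eqP: D; rewrite e0 mul0r mulr0 subr0 eq_sym oner_eq0.
have red0 b c d e f g h i :
  1 * (e * i - f * h) - b * (d * i - f * g) + c * (d * h - e * g) = 1 ->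
  P (mk3 1 b c d e f g h i).
  move=> D; apply: (row10 (- d)); apply: (row20 (- g)).
  have := @red1 b c (e - d * b) (f - d * c) (h - g * b) (i - g * c).
  rewrite (_ : _ - _ = 1); last by rewrite -[RHS]D; ring.
  move/(_ erefl); congr (P (mk3 _ _ _ _ _ _ _ _ _)); ring.
have redd a b c d e f g h i : d != 0 ->
  a * (e * i - f * h) - b * (d * i - f * g) + c * (d * h - e * g) = 1 ->
  P (mk3 a b c d e f g h i).
  move=> d0 D; apply: (row01 ((1 - a) / d)).
  rewrite mulfVK // addrC subrK; apply: red0.
  rewrite -[RHS]D.
  have -> : a * (e * i - f * h) = (a - 1 + 1) * (e * i - f * h) by ring.
  have -> : a - 1 = - ((1 - a) / d * d) by rewrite mulfVK //; ring.
  by ring.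
move=> A; have [a [b [c [d [e [f [g [h [i ->]]]]]]]]] := mk3E A.
rewrite det_mk3 => D.
have [d0|] := eqVneq d 0; last by move=> d0; apply: redd.
have [g0|g0] := eqVneq g 0.
  apply: (row10 1); apply: redd; last by rewrite -[RHS]D; ring.
  rewrite d0 add0r mul1r; apply/eqP => a0; move/eqP: D.
  by rewrite a0 d0 g0 !(mul0r, mulr0, subr0, addr0) eq_sym oner_eq0.
apply: (row12 1); apply: redd; last by rewrite -[RHS]D; ring.
by rewrite d0 add0r mul1r.
Qed.

Lemma perm2K (rho : {perm 'I_2}) : involutive rho.
Proof.
have E (i j l : 'I_2) : i != l -> j != l -> i = j.
  by move: i j l => [[|[|//]] ?] [[|[|//]] ?] [[|[|//]] ?] // _ _; apply: val_inj.
move=> i; have [ri|ri] := eqVneq (rho i) i; first by rewrite !ri.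
by apply: (E _ _ (rho i)); rewrite ?(inj_eq perm_inj) // eq_sym.
Qed.

Lemma det_root i t : \det (xroot i t) = 1 /\ \det (yroot i t) = 1.
Proof.
have [X0 X1 Y0 Y1] := root_mk3 t.
have [->|->] : i = 0 \/ i = 1.
- by case: i => [[|[|//]] ?]; [left|right]; apply: val_inj.
- by rewrite X0 Y0 !det_mk3; split; ring.
- by rewrite X1 Y1 !det_mk3; split; ring.
Qed.

(* Hence <sigma> = {1, sigma} as soon as sigma is not the identity. *)
Lemma gautK (sigma : graph_aut) : involutive sigma.
Proof.
have [h [rho [hU pin]]] := gaut_pinned sigma.
have conj_det (X : 'M[k]_3) : \det X = 1 -> \det (h *m X *m invmx h) == 1.
  by move=> dX; rewrite !det_mulmx dX mulr1 det_inv divrr // -unitmxE.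
pose P (B : 'M[k]_3) := \det B = 1 /\ forall A : SL k 3,
  A = h *m B *m invmx h :> 'M_3 -> sigma (sigma A) = A.
have PP : forall B : 'M_3, \det B = 1 -> P B.
  apply: SL3_root_ind => [B C [dB PB] [dC PC]|i t|i t].
  - split=> [|A AE]; first by rewrite det_mulmx dB dC mulr1.
    pose B' := MkSL (conj_det _ dB); pose C' := MkSL (conj_det _ dC).
    have -> : A = (B' * C')%g.
      by apply: val_inj; rewrite [LHS]AE /= !mulmxA mulmxKV.
    by rewrite !gautM PB ?PC.
  - have [dx _] := det_root i t; split=> // A AE.
    have := proj1 (pin _ t _) (proj1 (pin _ t A) AE).
    by rewrite perm2K -AE => /val_inj.
  - have [_ dy] := det_root i t; split=> // A AE.
    have := proj2 (pin _ t _) (proj2 (pin _ t A) AE).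
    by rewrite perm2K -AE => /val_inj.
move=> A; have dA : \det (invmx h *m A *m h) = 1.
  by rewrite !det_mulmx sl_det mulr1 det_inv mulVr // -unitmxE.
by have [_ ->] := PP _ dA; rewrite // !mulmxA mulmxV // mul1mx mulmxK.
Qed.

Lemma gaut1 (sigma : graph_aut) : sigma 1%g = 1%g.
Proof. by apply: (mulgI (sigma 1%g)); rewrite -gautM !mulg1. Qed.

End GraphAutomorphism.

(* Sdp sigma A b stands for the element A sigma^b of the semidirect product of
   SL_3 and <sigma>. *)
Record SL3_sdp (k : fieldType) (sigma : graph_aut k) :=
  Sdp { sdp_sl : SL k 3; sdp_exp : bool }.

Section SemidirectProduct.
Variables (k : fieldType) (sigma : graph_aut k).
Local Notation SL3_sdp := (SL3_sdp sigma).
Local Notation Sdp := (Sdp sigma).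

Definition sdp_pair (x : SL3_sdp) := (sdp_sl x, sdp_exp x).
Definition pair_sdp (u : SL k 3 * bool) : SL3_sdp := Sdp u.1 u.2.

Fact sdp_pairK : cancel sdp_pair pair_sdp. Proof. by case. Qed.

HB.instance Definition _ := Choice.copy SL3_sdp (can_type sdp_pairK).

Definition gaut_pow (b : bool) (A : SL k 3) : SL k 3 := if b then sigma A else A.

Fact gaut_powM b : {morph gaut_pow b : A B / (A * B)%g}.
Proof. by case: b => //=; apply: gautM. Qed.
Fact gaut_pow_addb a b A : gaut_pow (a (+) b) A = gaut_pow a (gaut_pow b A).
Proof. by case: a b => [] [] //=; rewrite gautK. Qed.
Fact gaut_pow1 b : gaut_pow b 1%g = 1%g.
Proof. by case: b => //=; apply: gaut1. Qed.

Definition sdp_one : SL3_sdp := Sdp 1%g false.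
Definition sdp_mul (x y : SL3_sdp) : SL3_sdp :=
  Sdp (sdp_sl x * gaut_pow (sdp_exp x) (sdp_sl y))%g (sdp_exp x (+) sdp_exp y).
Definition sdp_inv (x : SL3_sdp) : SL3_sdp :=
  Sdp (gaut_pow (sdp_exp x) (sdp_sl x)^-1)%g (sdp_exp x).

Fact sdp_mulA : associative sdp_mul.
Proof.
case=> [A a] [B b] [C c].
by rewrite /sdp_mul /= gaut_powM gaut_pow_addb mulgA addbA.
Qed.
Fact sdp_mul1 : left_id sdp_one sdp_mul.
Proof. by case=> A a; rewrite /sdp_mul /= mul1g. Qed.
Fact sdp_1mul : right_id sdp_one sdp_mul.
Proof. by case=> A a; rewrite /sdp_mul /= gaut_pow1 mulg1 addbF. Qed.
Fact sdp_mulV : left_inverse sdp_one sdp_inv sdp_mul.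
Proof.
by case=> A a; rewrite /sdp_mul /= -gaut_powM mulVg gaut_pow1 addbb.
Qed.
Fact sdp_Vmul : right_inverse sdp_one sdp_inv sdp_mul.
Proof.
by case=> A a; rewrite /sdp_mul /= -gaut_pow_addb addbb mulgV.
Qed.

HB.instance Definition _ :=
  isGroup.Build SL3_sdp sdp_mulA sdp_mul1 sdp_1mul sdp_mulV sdp_Vmul.

(* As a variety, the group is the disjoint union of two copies of SL_3: a
   function is regular iff it is polynomial in the matrix entries on each. *)
Definition sdp_regular : set (SL3_sdp -> k) :=
  [set f | forall b : bool, exists p : {mpoly k[3 * 3]},
     forall A : SL k 3, f (Sdp A b) = p.@[fun i => mxvec A 0 i]].

End SemidirectProduct.

Arguments sdp_regular {k} sigma f.

(* Main.v *)
Require Import Defs.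
From HB Require Import structures.
From mathcomp Require Import all_boot all_order all_fingroup all_algebra.
From mathcomp Require Import mpoly ring.
From mathcomp Require Import boolp classical_sets functions cardinality.

Set Implicit Arguments.
Unset Strict Implicit.
Unset Printing Implicit Defensive.

Import GRing.Theory.
Local Open Scope classical_set_scope.
Local Open Scope ring_scope.

(** In characteristic 2 the automorphism sigma is conjugate to A |-> J A^-T J
    with J antidiagonal, and it centralises the corner copy of SL_2 acting on
    the first and third coordinates.  Take M = SL_2 x <sigma>.  It is reductive
    because connected subgroups of M lie in SL_2, and in SL_2 the unipotent
    elements have trace 0, while a normal subgroup of traceless elements is
    trivial.  With x(t) the upper root elements of SL_2, the pairs
    (x(t) sigma, x(1)) are pairwise non-conjugate in M, as the centraliser of
    x(1) in M centralises x(t).  But they are all conjugate in G: the matrix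
    g = [[1,q,q^2],[0,1,q],[0,0,1]] commutes with x(1), and
    g sigma g^-1 = x(q^2) sigma. *)

(** * Closed sets and algebraically closed fields *)

Lemma zclosedP (k : closedFieldType) (G : groupType) (kG : set (G -> k))
    (S : set G) :
  (forall y, (forall f, kG f -> (forall x, S x -> f x = 0) -> f y = 0) -> S y) ->
  zclosed kG S.
Proof.
move=> SP; exists [set f | kG f /\ forall x, S x -> f x = 0].
  by move=> f [].
rewrite eqEsubset; split=> [x Sx f [_ /(_ x Sx)] //|y /= Hy].
by apply: SP => f kf fS; apply: Hy.
Qed.

(** Euclid's argument: if [s] listed the field, the product of the X - a plus 1 would have a root
    outside [s]. *)
Lemma closed_field_infinite (k : closedFieldType) : infinite_set [set: k].
Proof.
move=> /finite_seqP [s sE].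
pose p : {poly k} := \prod_(a <- s) ('X - a%:P) + 1.
(* For empty [s] the polynomial would be constant; 0 rules this case out. *)
have [s0|s0] := eqVneq (size s) 0%N.
  have : [set: k] 0 by [].
  by rewrite sE (size0nil s0).
have sp : size p = (size s).+1.
  by rewrite size_polyDl size_prod_XsubC // size_poly1 ltnS lt0n.
have /closed_rootP [x /rootP] : size p != 1%N by rewrite sp eqSS.
have xs : x \in s by have : [set: k] x by []; rewrite sE.
rewrite hornerD hornerC (rootP _) ?root_prod_XsubC // add0r => /eqP.
by rewrite oner_eq0.
Qed.

(** * Matrix computations in SL_2 *)

Section SL2.
Variable k : fieldType.

Definition mk2 (a b c d : k) : 'M[k]_2 :=
  \matrix_(r, s) nth 0 (nth [::] [:: [:: a; b]; [:: c; d]] r) s.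

Lemma mk2E (A : 'M[k]_2) : A = mk2 (A 0 0) (A 0 1) (A 1 0) (A 1 1).
Proof.
apply/matrixP => -[[|[|//]] ?] [[|[|//]] ?]; rewrite mxE /=;
  congr (A _ _); exact/val_inj.
Qed.

Lemma det_mx22 (A : 'M[k]_2) : \det A = A 0 0 * A 1 1 - A 0 1 * A 1 0.
Proof.
rewrite [in LHS](mk2E A) (expand_det_row _ 0) !big_ord_recl big_ord0 /cofactor.
by rewrite !det_mx11 !mxE /=; ring.
Qed.

Lemma mul_mk2 a b c d a' b' c' d' :
  mk2 a b c d *m mk2 a' b' c' d' =
  mk2 (a * a' + b * c') (a * b' + b * d') (c * a' + d * c') (c * b' + d * d').
Proof.
by apply/matrixP => -[[|[|//]] ?] [[|[|//]] ?];
  rewrite mxE !big_ord_recl big_ord0 !mxE /=; ring.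
Qed.

Lemma mk2_1 : 1%:M = mk2 1 0 0 1.
Proof. by apply/matrixP => -[[|[|//]] ?] [[|[|//]] ?]; rewrite !mxE. Qed.

Lemma mk2_inj a b c d a' b' c' d' : mk2 a b c d = mk2 a' b' c' d' ->
  [/\ a = a', b = b', c = c' & d = d'].
Proof.
move=> /matrixP E.
by split; [have := E 0 0|have := E 0 1|have := E 1 0|have := E 1 1]; rewrite !mxE.
Qed.

Lemma det_mk2 a b c d : \det (mk2 a b c d) = a * d - b * c.
Proof. by rewrite det_mx22 !mxE. Qed.

Lemma sl2P (X : SL k 2) :
  exists a b c d, a * d - b * c = 1 /\ X = mk2 a b c d :> 'M_2.
Proof.
exists (X 0 0), (X 0 1), (X 1 0), (X 1 1).
by rewrite -det_mx22 sl_det -mk2E.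
Qed.

Fact det_uni2_subproof t : \det (mk2 1 t 0 1) == 1.
Proof. by rewrite det_mk2 !mulr0 subr0 mulr1. Qed.
Definition uni2 t : SL k 2 := MkSL (det_uni2_subproof t).

Lemma uni2_inj : injective uni2.
Proof. by move=> t u /(congr1 (@sl_mx _ _)) /mk2_inj []. Qed.

(* The centraliser of a nontrivial element of a root group of SL_2 is the
   product of the root group with the centre. *)
Lemma commute_uni2 (X : SL k 2) t :
  (X * uni2 1 = uni2 1 * X)%g -> (X * uni2 t = uni2 t * X)%g.
Proof.
have [a [b [c [d [_ E]]]]] := sl2P X.
move=> /(congr1 (@sl_mx _ _)); rewrite /= !E !mul_mk2.
move=> /mk2_inj [+ + _ _]; rewrite !(mulr1, mulr0, mul0r, mul1r, addr0).
move=> /eqP; rewrite -subr_eq0 opprD addNKr oppr_eq0 => /eqP c0.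
rewrite addrC => /addrI ad; subst c d.
apply/val_inj; rewrite /= !E !mul_mk2; congr mk2; ring.
Qed.

Section Char2.
Hypothesis char2 : 2%N \in [pchar k].

(** Frobenius: squaring is additive in characteristic 2, and a field has no nonzero element of
    square 0. *)
Lemma sqr_inj_char2 : injective (fun x : k => x ^+ 2).
Proof.
move=> x y /eqP; rewrite -subr_eq0 => xy; apply/eqP; rewrite -subr_eq0.
rewrite -sqrf_eq0; move: xy; congr (_ == 0).
have -> : (x - y) ^+ 2 = x ^+ 2 - y ^+ 2 + (y * (y - x) + y * (y - x)) by ring.
by rewrite addrr_pchar2 ?addr0.
Qed.

(* A conjugate of an element of N by diag(t, t^-1) multiplies it to an element
   of trace b c (t + t^-1)^2, so b c = 0; then conjugation by a Weyl group
   element gives the trace b^2 + c^2. *)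
Lemma normal_traceless_trivial (N : set (SL k 2)) (t : k) :
  t != 0 -> t != 1 -> (forall X Y, N X -> N Y -> N (X * Y)%g) ->
  (forall X Y, N X -> N (X ^ Y)%g) ->
  (forall X : SL k 2, N X -> \tr (sl_mx X) = 0) ->
  forall X, N X -> X = 1%g.
Proof.
move=> t0 t1 NM NJ Ntr X NX.
have [a [b [c [d [dX E]]]]] := sl2P X.
have tr a' b' c' d' : \tr (mk2 a' b' c' d') = a' + d'.
  by rewrite /mxtrace !big_ord_recl big_ord0 !mxE /= addr0.
have ad : d = a.
  have := Ntr X NX; rewrite E tr => /eqP; rewrite addr_eq0 => /eqP ->.
  by rewrite oppr_pchar2.
subst d.
(* The matrix is X X^Y for Y = [[p, q], [r, u]], whose inverse is its adjugate; the product lies in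
   [N]. *)
have trXY p q r u : p * u - q * r = 1 ->
    \tr (mk2 a b c a *m (mk2 u (- q) (- r) p *m (mk2 a b c a *m mk2 p q r u)))
    = 0 :> k.
  move=> D; have D' : \det (mk2 p q r u) == 1 by rewrite det_mk2 D.
  have VE : sl_mx (MkSL D')^-1%g = mk2 u (- q) (- r) p.
    rewrite -[RHS](mulmxK (sl_unit (MkSL D'))) /= mul_mk2 -[LHS]mul1mx mk2_1.
    by congr (mk2 _ _ _ _ *m _); rewrite -?D; ring.
  by have := Ntr _ (NM _ _ NX (NJ X (MkSL D') NX)); rewrite conjgE /= -VE E.
have bc : b * c = 0.
  have := trXY t^-1 0 0 t; rewrite mulVf // mulr0 subr0 => /(_ erefl).
  rewrite !mul_mk2 tr => H.
  have : b * c * (t + t^-1) ^+ 2 = 0.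
    rewrite -[RHS]H.
    have -> : b * c * (t + t^-1) ^+ 2 =
      b * c * (t ^+ 2 + t^-1 ^+ 2) + b * c * (t^-1 * t) * (1 + 1) by ring.
    have -> : (1 + 1 : k) = 0 by rewrite addrr_pchar2.
    rewrite mulr0 addr0.
    transitivity (b * c * (t ^+ 2 + t^-1 ^+ 2) + a ^+ 2 * (t^-1 * t) * (1 + 1)).
      by rewrite addrr_pchar2 // mulr0 addr0.
    by ring.
  (* If t + t^-1 = 0, then t = t^-1, so t^2 = 1 and t = 1. *)
  move=> /eqP; rewrite mulf_eq0 sqrf_eq0 => /orP [/eqP //|].
  rewrite addr_eq0 oppr_pchar2 // => /eqP tV; case/eqP: t1.
  by apply: sqr_inj_char2; rewrite /= expr1n expr2 [X in _ * X]tV mulfV.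
have b2c2 : b ^+ 2 + c ^+ 2 = 0.
  have := trXY 0 1 (-1) 0; rewrite mul0r mul1r sub0r opprK => /(_ erefl).
  rewrite !mul_mk2 tr => H.
  rewrite -oppr0 -[X in - X]H.
  transitivity (b ^+ 2 + c ^+ 2 - a ^+ 2 * (1 + 1)); last by ring.
  by rewrite addrr_pchar2 // mulr0 subr0.
have [b0 c0] : b = 0 /\ c = 0.
  move/eqP: bc b2c2; rewrite mulf_eq0 => /orP [] /eqP ->; rewrite expr0n /=.
    by rewrite add0r => /eqP; rewrite sqrf_eq0 => /eqP.
  by rewrite addr0 => /eqP; rewrite sqrf_eq0 => /eqP.
have a1 : a = 1.
  by apply: sqr_inj_char2; rewrite /= expr1n -dX b0 mul0r subr0.
by apply/val_inj; rewrite /= E a1 b0 c0 mk2_1.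
Qed.

End Char2.
End SL2.

(** * Conjugation of SL_n by an invertible matrix *)

Section ConjugatedSL.
Variables (k : fieldType) (n : nat) (h : 'M[k]_n).
Hypothesis hU : h \in unitmx.

Fact slconj_subproof (A : SL k n) : \det (h *m A *m invmx h) == 1.
Proof.
by rewrite !det_mulmx sl_det mulr1 det_inv divrr // -unitmxE.
Qed.
Definition slconj A : SL k n := MkSL (slconj_subproof A).

Lemma slconjM : {morph slconj : A B / (A * B)%g}.
Proof. by move=> A B; apply/val_inj; rewrite /= !mulmxA mulmxKV. Qed.

Lemma slconjK A : invmx h *m slconj A *m h = A.
Proof. by rewrite /= !mulmxA mulVmx // mul1mx mulmxKV. Qed.

Lemma slconj_onto A : exists B, A = slconj B.
Proof.
have dB : \det (invmx h *m A *m h) == 1.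
  by rewrite !det_mulmx sl_det mulr1 det_inv mulVr // -unitmxE.
exists (MkSL dB); apply/val_inj => /=.
by rewrite !mulmxA mulmxV // mul1mx mulmxK.
Qed.

End ConjugatedSL.

(** * The graph automorphism in matrix form *)

Section GraphAutomorphism.
Variables (k : fieldType) (sigma : graph_aut k).
Hypothesis sigma_nontrivial : exists A, sigma A <> A.
Hypothesis char2 : 2%N \in [pchar k].

(** Root elements generate SL_3, so a multiplicative relation that holds between each root element
    and its image holds along the whole graph of [sigma], read in the basis [h]. *)
Lemma gaut_rel_ind (h : 'M[k]_3) (hU : h \in unitmx) (rho : {perm 'I_2})
    (P : 'M[k]_3 -> 'M[k]_3 -> Prop) :
  (forall i t (A : SL k 3),
    (A = h *m xroot i t *m invmx h :> 'M_3 ->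
       sigma A = h *m xroot (rho i) t *m invmx h :> 'M_3) /\
    (A = h *m yroot i t *m invmx h :> 'M_3 ->
       sigma A = h *m yroot (rho i) t *m invmx h :> 'M_3)) ->
  (forall A B C D, P A B -> P C D -> P (A *m C) (B *m D)) ->
  (forall i t, P (xroot i t) (xroot (rho i) t)) ->
  (forall i t, P (yroot i t) (yroot (rho i) t)) ->
  forall A : SL k 3,
    exists2 B : SL k 3, sigma (slconj hU A) = slconj hU B & P A B.
Proof.
move=> pin PM Px Py.
(* The determinant is part of [Q] so that both factors of a product can be repackaged as elements of
   SL_3. *)
pose Q (X : 'M[k]_3) := \det X = 1 /\ forall A : SL k 3, A = X :> 'M_3 ->
  exists2 B : SL k 3, sigma (slconj hU A) = slconj hU B & P A B.
have QQ : forall X : 'M_3, \det X = 1 -> Q X.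
  apply: SL3_root_ind => [X Y [dX QX] [dY QY]|i t|i t].
  - split=> [|A AE]; first by rewrite det_mulmx dX dY mulr1.
    move/eqP: dX => dX; move/eqP: dY => dY.
    have [X' sX PX] := QX (MkSL dX) erefl.
    have [Y' sY PY] := QY (MkSL dY) erefl.
    have -> : A = (MkSL dX * MkSL dY)%g by apply/val_inj.
    by exists (X' * Y')%g; [rewrite !slconjM gautM sX sY | apply: PM].
  - split=> [|A AE]; first by case: (det_root i t).
    have [/eqP d _] := det_root (rho i) t; exists (MkSL d); last by rewrite AE.
    by apply/val_inj => /=; apply: (proj1 (pin i t _)); rewrite /= AE.
  - split=> [|A AE]; first by case: (det_root i t).
    have [_ /eqP d] := det_root (rho i) t; exists (MkSL d); last by rewrite AE.
    by apply/val_inj => /=; apply: (proj2 (pin i t _)); rewrite /= AE.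
by move=> A; apply: (proj2 (QQ A (sl_det A))).
Qed.

Definition antidiag : 'M[k]_3 := mk3 0 0 1 0 1 0 1 0 0.

Lemma antidiagK : antidiag *m antidiag = 1%:M.
Proof. by rewrite mul_mk3 mk3_1; congr mk3; ring. Qed.

Lemma tr_mk3 (a b c d e f g i j : k) :
  (mk3 a b c d e f g i j)^T = mk3 a d g b e i c f j.
Proof. by apply/matrixP => -[[|[|[|//]]] ?] [[|[|[|//]]] ?]; rewrite !mxE. Qed.

Lemma ord2P (i : 'I_2) : i = 0 \/ i = 1.
Proof. by case: i => -[|[|//]] ?; [left|right]; apply/val_inj. Qed.

(* In characteristic 2 the signs in the standard graph automorphism disappear:
   it sends A to J A^-T J^-1 with J antidiagonal with entries 1. *)
Lemma gaut_form : exists (h : 'M[k]_3) (hU : h \in unitmx),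
  forall A B : SL k 3, B *m antidiag *m A^T = antidiag ->
  sigma (slconj hU A) = slconj hU B.
Proof.
have [h [rho [hU pin]]] := gaut_pinned sigma; exists h, hU.
(* If [rho] fixes a node it is trivial; then [sigma] fixes all root elements, hence everything,
   against nontriviality. *)
have [rho0|rho0] := eqVneq (rho 0) 0.
  have rhoE i : rho i = i.
    have [->//|i1] := ord2P i; have : rho i != 0.
      by rewrite -rho0 (inj_eq perm_inj) i1.
    by case: (ord2P (rho i)) => ->; rewrite ?i1 // eqxx.
  have [A []] := sigma_nontrivial.
  have [B ->] := slconj_onto hU A.
  have [| | |C -> /val_inj -> //] :=
    @gaut_rel_ind h hU rho (fun X Y => Y = X) pin _ _ _ B => //.
  - by move=> ? ? ? ? -> ->.
  - by move=> i t; rewrite rhoE.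
  - by move=> i t; rewrite rhoE.
have rho_0 : rho 0 = 1 by case: (ord2P (rho 0)) rho0 => -> //; rewrite eqxx.
have simp := (mul0r, mulr0, mul1r, mulr1, add0r, addr0).
have rho_1 : rho 1 = 0 by rewrite -rho_0 perm2K.
move=> A B BJA.
have [X Y U V XY UV|i t|i t|C -> CJA] := @gaut_rel_ind h hU rho
  (fun X Y => Y *m antidiag *m X^T = antidiag) pin _ _ _ A.
- rewrite trmx_mul !mulmxA -(mulmxA Y V) -(mulmxA Y (V *m _)) UV.
  exact: XY.
- have [X0 X1 _ _] := root_mk3 t.
  by have [->|->] := ord2P i; rewrite ?rho_0 ?rho_1 X0 X1 tr_mk3 !mul_mk3;
    congr mk3; rewrite ?simp ?addrr_pchar2.
- have [_ _ Y0 Y1] := root_mk3 t.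
  by have [->|->] := ord2P i; rewrite ?rho_0 ?rho_1 Y0 Y1 tr_mk3 !mul_mk3;
    congr mk3; rewrite ?simp ?addrr_pchar2.
(* J A^T is invertible, so the equation determines its left factor: [C] is [B]. *)
- have AU : antidiag *m A^T \in unitmx.
    rewrite unitmx_mul unitmx_tr sl_unit andbT.
    by case: (mulmx1_unit antidiagK).
  congr slconj; apply/val_inj; apply: (can_inj (mulmxK AU)).
  by rewrite !mulmxA BJA.
Qed.

End GraphAutomorphism.

(** * Regular functions on G *)

Section RegularFunctions.
Variables (k : fieldType) (sigma : graph_aut k).
Local Notation G := (SL3_sdp sigma).
Local Notation regular := (sdp_regular sigma).

Lemma regular_cst (c : k) : regular (fun=> c).
Proof. by move=> b; exists c%:MP => A; rewrite mevalC. Qed.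

Lemma regularD f g : regular f -> regular g -> regular (fun y => f y + g y).
Proof.
move=> rf rg b; have [p fp] := rf b; have [q gq] := rg b.
by exists (p + q) => A; rewrite fp gq mevalD.
Qed.

Lemma regularM f g : regular f -> regular g -> regular (fun y => f y * g y).
Proof.
move=> rf rg b; have [p fp] := rf b; have [q gq] := rg b.
by exists (p * q) => A; rewrite fp gq mevalM.
Qed.

Lemma regular_sum (I : Type) (r : seq I) (F : I -> G -> k) :
  (forall i, regular (F i)) -> regular (fun y => \sum_(i <- r) F i y).
Proof.
move=> rF; elim: r => [|i r IH].
  rewrite (_ : (fun _ => _) = fun=> 0); first exact: regular_cst.
  by apply/funext => y; rewrite big_nil.
rewrite (_ : (fun _ => _) = fun y => F i y + \sum_(j <- r) F j y).
  exact: regularD.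
by apply/funext => y; rewrite big_cons.
Qed.

Lemma regular_entry i j : regular (fun y => sdp_sl y i j).
Proof. by move=> b; exists 'X_(mxvec_index i j) => A; rewrite mevalXU mxvecE. Qed.

Lemma regular_exp : regular (fun y => (sdp_exp y)%:R).
Proof. by move=> b; exists b%:R%:MP => A; rewrite mevalC. Qed.

(** With [invmx h] and [h] for [P] and [Q], this makes the entries in the basis [h] regular. *)
Lemma regular_entry_mul (P Q : 'M[k]_3) i j :
  regular (fun y => (P *m sdp_sl y *m Q) i j).
Proof.
rewrite (_ : (fun _ => _) = fun y : G =>
  \sum_s (\sum_r P i r * sdp_sl y r s) * Q s j); last first.
  by apply/funext => y; rewrite mxE; apply: eq_bigr => s _; rewrite mxE.
apply: regular_sum => s; apply: regularM; last exact: regular_cst.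
apply: regular_sum => r; apply: regularM; last exact: regular_entry.
exact: regular_cst.
Qed.

Lemma regular_separates x y : (forall f, regular f -> f x = f y) -> x = y.
Proof.
move=> E; have := E _ regular_exp.
have : sdp_sl x = sdp_sl y.
  by apply/val_inj/matrixP => i j; apply: (E _ (regular_entry i j)).
case: x y {E} => [A [] [B []]] /= -> // /eqP.
  by rewrite oner_eq0.
by rewrite eq_sym oner_eq0.
Qed.

End RegularFunctions.

(** * The subgroup M = SL_2 x <sigma> *)

Section CornerSubgroup.
Variables (k : closedFieldType) (sigma : graph_aut k).
Hypothesis char2 : 2%N \in [pchar k].
Variables (h : 'M[k]_3) (hU : h \in unitmx).
Hypothesis gaut_slconj : forall A B : SL k 3,
  B *m antidiag k *m A^T = antidiag k -> sigma (slconj hU A) = slconj hU B.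
Local Notation G := (SL3_sdp sigma).
Local Notation regular := (sdp_regular sigma).
Local Notation simp := (mul0r, mulr0, mul1r, mulr1, add0r, addr0).

Definition corner (A : 'M[k]_2) : 'M[k]_3 :=
  mk3 (A 0 0) 0 (A 0 1) 0 1 0 (A 1 0) 0 (A 1 1).

Lemma corner_mk2 a b c d : corner (mk2 a b c d) = mk3 a 0 b 0 1 0 c 0 d.
Proof. by rewrite /corner !mxE. Qed.

Lemma mk3_inj (a b c d e f g i j a' b' c' d' e' f' g' i' j' : k) :
  mk3 a b c d e f g i j = mk3 a' b' c' d' e' f' g' i' j' ->
  [/\ [/\ a = a', b = b' & c = c'], [/\ d = d', e = e' & f = f']
    & [/\ g = g', i = i' & j = j']].
Proof.
move=> /matrixP E; split; split;
  [have := E 0 0|have := E 0 1|have := E 0 ord_max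
  |have := E 1 0|have := E 1 1|have := E 1 ord_max
  |have := E ord_max 0|have := E ord_max 1|have := E ord_max ord_max];
  by rewrite !mxE.
Qed.

Fact det_corner_subproof (X : SL k 2) : \det (corner X) == 1.
Proof. by apply/eqP; rewrite det_mk3 -[RHS](sl_det X) det_mx22; ring. Qed.
Definition sl_corner X : SL k 3 := MkSL (det_corner_subproof X).

Lemma sl_cornerM : {morph sl_corner : X Y / (X * Y)%g}.
Proof.
move=> X Y; apply/val_inj => /=.
by rewrite (mk2E X) (mk2E Y) mul_mk2 !corner_mk2 mul_mk3 !simp.
Qed.

(** In characteristic 2 the form J is alternating on the span of the first and third basis vectors,
    and SL_2 = Sp_2 preserves it. *)
Lemma gaut_corner X : sigma (slconj hU (sl_corner X)) = slconj hU (sl_corner X).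
Proof.
apply: gaut_slconj => /=.
have [a [b [c [d [D ->]]]]] := sl2P X.
rewrite corner_mk2 tr_mk3 !mul_mk3 !simp; congr mk3.
- by rewrite mulrC addrr_pchar2.
- by rewrite -D addrC -[- _]oppr_pchar2 ?opprK //; ring.
- by rewrite -D -[- _]oppr_pchar2 ?opprK //; ring.
- by rewrite mulrC addrr_pchar2.
Qed.

Definition emb (X : SL k 2) (b : bool) : G :=
  Sdp sigma (slconj hU (sl_corner X)) b.

Lemma embM X Y a b : (emb X a * emb Y b)%g = emb (X * Y)%g (a (+) b).
Proof.
by congr Sdp; rewrite sl_cornerM slconjM; case: a => //=; rewrite gaut_corner.
Qed.

Lemma emb_inj X Y a b : emb X a = emb Y b -> X = Y /\ a = b.
Proof.
case=> /(congr1 (fun A => invmx h *m A *m h)).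
rewrite !(slconjK hU (sl_corner _)) /= => /mk3_inj [[e00 _ e01] _ [e10 _ e11]] ->.
by split=> //; apply/val_inj; rewrite /= (mk2E X) (mk2E Y) e00 e01 e10 e11.
Qed.

Lemma emb1 : emb 1%g false = 1%g.
Proof. by apply: (mulgI (emb 1%g false)); rewrite embM !mulg1. Qed.

Lemma embV X b : (emb X b)^-1%g = emb X^-1%g b.
Proof.
by apply: (mulgI (emb X b)); rewrite embM !mulgV addbb emb1.
Qed.

Definition sl2_sdp : set G := [set y | exists X b, y = emb X b].

Lemma sl2_sdp_subgroup : subgroup sl2_sdp.
Proof.
split.
- by exists 1%g, false; rewrite emb1.
- by move=> _ _ [X [a ->]] [Y [b ->]]; rewrite embM; exists (X * Y)%g, (a (+) b).
- by move=> _ [X [a ->]]; rewrite embV; exists X^-1%g, a.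
Qed.

Lemma sl2_sdp_closed : zclosed regular sl2_sdp.
Proof.
apply: zclosedP => y Hy.
(* An entry that is constant on corner matrices yields a regular function vanishing on M. *)
have cut i j c : (forall X, corner X i j = c) ->
    (invmx h *m sdp_sl y *m h) i j = c.
  move=> E; apply/eqP; rewrite -subr_eq0; apply/eqP.
  have rf := regularD (regular_entry_mul sigma (invmx h) h i j)
                      (regular_cst sigma (- c)).
  apply: (Hy _ rf) => _ [X [b ->]].
  by rewrite [sdp_sl _]/= slconjK E subrr.
case: y Hy cut => y b /= _; have [B ->] := slconj_onto hU y;
  rewrite slconjK => cut.
have [a1 [a2 [a3 [a4 [a5 [a6 [a7 [a8 [a9 BE]]]]]]]]] := mk3E B.
(* The five entries off the corners are constant; the four that remain form a matrix of determinant
   1. *)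
have := cut 0 1 0; have := cut 1 0 0; have := cut 1 1 1.
have := cut 1 ord_max 0; have := cut ord_max 1 0; rewrite BE !mxE /=.
do 5 (move/(_ (fun X => mxE _ _ _ _)) => ?); subst a2 a4 a5 a6 a8.
have dX : \det (mk2 a1 a3 a7 a9) == 1.
  by apply/eqP; rewrite -[RHS](sl_det B) BE det_mk3 det_mk2; ring.
exists (MkSL dX), b; congr (Sdp _ (slconj hU _) _).
by apply/val_inj; rewrite /= BE corner_mk2.
Qed.

(** * Connectedness and the unipotent radical of M *)

Lemma exp_closed b : zclosed regular [set y | sdp_exp y = b].
Proof.
apply: zclosedP => y Hy.
have rf := regularD (regular_exp sigma) (regular_cst sigma (- b%:R)).
have : (sdp_exp y)%:R - b%:R = 0 :> k.
  by apply: (Hy _ rf) => x /= ->; rewrite subrr.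
by rewrite /=; case: (sdp_exp y) b {Hy rf} => [] [] // /eqP;
  rewrite ?subr0 ?sub0r ?oppr_eq0 oner_eq0.
Qed.

(** The two cosets of SL_3 are closed and disjoint, and they cover G. *)
Lemma zconnected_exp S x : zconnected regular S -> S x ->
  S `<=` [set y | sdp_exp y = sdp_exp x].
Proof.
move=> /(_ _ _ (exp_closed (sdp_exp x)) (exp_closed (~~ sdp_exp x))) conn Sx.
have [||//|/(_ x Sx)/=] := conn.
- by move=> y _ /=; case: (sdp_exp y) (sdp_exp x) => [] []; [left|right|right|left].
- rewrite eqEsubset; split=> // y [[_ /= ->]] /=.
  by case: (sdp_exp x).
- by case: (sdp_exp x).
Qed.

Lemma sl2_sdp_not_connected : ~ zconnected regular sl2_sdp.
Proof.
move=> /zconnected_exp /(_ (ex_intro _ 1%g (ex_intro _ false erefl))).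
by move=> /(_ (emb 1%g true)) /(_ (ex_intro _ 1%g (ex_intro _ true erefl))).
Qed.

(* Right translation by X stabilises the span of the two corner entries of the
   first row and acts there as X, so X - 1 is nilpotent; its determinant is
   2 - tr X. *)
Lemma unipotent_emb_tr X : unipotent regular (emb X false) -> \tr (sl_mx X) = 0.
Proof.
have [a [b [c [d [D XE]]]]] := sl2P X.
pose co i j (y : G) := (invmx h *m sdp_sl y *m h) i j.
pose F (u : k * k) (y : G) := co 0 0 y * u.1 + co 0 ord_max y * u.2.
pose N (u : k * k) := ((a - 1) * u.1 + b * u.2, c * u.1 + (d - 1) * u.2).
have rF u : regular (F u).
  by apply: regularD; apply: regularM; try exact: regular_cst;
    apply: regular_entry_mul.
have FN u Y : rtrans (emb X false) (F u) (emb Y false) - F u (emb Y false)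
              = F (N u) (emb Y false).
  rewrite /rtrans embM /F /co ![sdp_sl _]/= !slconjK.
  rewrite /= XE (mk2E Y) mul_mk2 !corner_mk2 !mxE /=; ring.
move=> /(_ _ (rF (1, 0))) [n Fn].
(* Restricting to the points [emb Y false] suffices: right translation by X preserves them. *)
have iterF m : forall Y,
    iter m (fun (f : G -> k) y => rtrans (emb X false) f y - f y)
    (F (1, 0)) (emb Y false) = F (iter m N (1, 0)) (emb Y false).
  elim: m => [//|m IH] Y /=.
  by rewrite -FN -IH /rtrans embM IH.
(* The values at [1] and [uni2 1] are p and p + q. *)
have F0 u : (forall Y, F u (emb Y false) = 0) -> u = (0, 0).
  case: u => p q Fpq; have := Fpq 1%g; have := Fpq (uni2 1).
  rewrite /F /co ![sdp_sl _]/= !slconjK /= mk2_1 !corner_mk2 !mxE /= !simp.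
  move=> q0 p0; congr pair => //.
  by rewrite -[q]add0r -{1}p0.
have {F0 Fn} iter0 : iter n N (1, 0) = (0, 0).
  by apply: F0 => Y; rewrite -iterF Fn.
(* Multiplying by the adjugate of X - 1 shows that [N] is injective if its determinant is nonzero;
   no iterate then kills (1, 0). *)
have Ninj u : (a - 1) * (d - 1) - b * c != 0 -> N u = (0, 0) -> u = (0, 0).
  case: u => p q e0 [/= N1 N2]; congr pair; apply: (mulfI e0); rewrite mulr0.
    transitivity ((d - 1) * ((a - 1) * p + b * q) - b * (c * p + (d - 1) * q)).
      by ring.
    by rewrite N1 N2 !mulr0 subr0.
  transitivity ((a - 1) * (c * p + (d - 1) * q) - c * ((a - 1) * p + b * q)).
    by ring.
  by rewrite N1 N2 !mulr0 subr0.
have [e0|e0] := eqVneq ((a - 1) * (d - 1) - b * c) 0.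
  rewrite XE /mxtrace !big_ord_recl big_ord0 !mxE /= addr0.
  have : a + d = a * d - b * c + 1 - ((a - 1) * (d - 1) - b * c) by ring.
  by rewrite e0 D subr0 addrr_pchar2.
elim: n iter0 {iterF} => [/(congr1 fst) /= /eqP|n IH /(Ninj _ e0) //].
by rewrite oner_eq0.
Qed.

Lemma unipotent_radical_sl2_sdp : unipotent_radical regular sl2_sdp = [set 1%g].
Proof.
rewrite eqEsubset; split=> [y|_ ->] /=; last first.
  (* The trivial group qualifies; it is closed because regular functions separate points. *)
  exists [set 1%g]; split=> //.
  - split; first by split=> [//|x y -> ->|x ->] /=; rewrite ?mulg1 ?invg1.
    apply: zclosedP => y Hy; apply: regular_separates => f rf.
    apply/eqP; rewrite -subr_eq0; apply/eqP.
    apply: (Hy _ (regularD rf (regular_cst sigma (- f 1%g)))) => x ->.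
    exact: subrr.
  - move=> A B _ _ /(_ 1%g erefl) [A1|B1] _; first by left=> x ->.
    by right=> x ->.
  - split=> [x ->|x z -> _]; first by case: sl2_sdp_subgroup.
    by rewrite /= conj1g.
  - move=> x -> f rf; exists 1%N => /=; apply/funext => z.
    by rewrite /rtrans mulg1 subrr.
move=> [U [[[U1 UM UV] _] conn [UsM UJ] Uuni Uy]].
(* As U is connected and contains 1, it stays in the coset SL_3. *)
have U0 := zconnected_exp conn U1.
have [X [b yE]] := UsM y Uy; subst y.
have /= b0 := U0 _ Uy; subst b.
pose N := [set Y | U (emb Y false)].
suff -> : X = 1%g by exact: emb1.
(* This provides the torus element diag(t, t^-1) used to kill b c. *)
have [t [t0 t1]] : exists t : k, t != 0 /\ t != 1.
  apply: contrapT => no_t; apply: (@closed_field_infinite k).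
  apply: sub_finite_set (finite_set2 0 1) => t _ /=.
  have [->|t0] := eqVneq t 0; first by left.
  have [->|t1] := eqVneq t 1; first by right.
  by case: no_t; exists t.
apply: (@normal_traceless_trivial _ char2 N t t0 t1) => //.
- by move=> Y Z NY NZ; rewrite /N /= -(embM Y Z false false); apply: UM.
- move=> Y Z NY; rewrite /N /=.
  suff -> : emb (Y ^ Z)%g false = (emb Y false ^ emb Z false)%g.
    by apply: UJ => //; exists Z, false.
  by rewrite !conjgE embV !embM.
- by move=> Y NY; apply/unipotent_emb_tr/Uuni.
Qed.

Lemma sl2_sdp_reductive : reductive regular sl2_sdp.
Proof.
by split; [split; [exact: sl2_sdp_subgroup | exact: sl2_sdp_closed]
          | exact: unipotent_radical_sl2_sdp].
Qed.

(** * Pairs of involutions conjugate in G but not in M *)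

Definition involution_pair (t : k) : G * G :=
  (emb (uni2 t) true, emb (uni2 1) false).

Fact det_shear_subproof (q : k) : \det (mk3 1 q (q ^+ 2) 0 1 q 0 0 1) == 1.
Proof. by apply/eqP; rewrite det_mk3; ring. Qed.
Definition shear q : SL k 3 := MkSL (det_shear_subproof q).

Fact det_shear_inner_subproof (q : k) : \det (mk3 1 q 0 0 1 q 0 0 1) == 1.
Proof. by apply/eqP; rewrite det_mk3; ring. Qed.
Definition shear_inner q : SL k 3 := MkSL (det_shear_inner_subproof q).

Lemma gaut_shear q : sigma (slconj hU (shear q)) = slconj hU (shear_inner q).
Proof.
apply: gaut_slconj; rewrite /= tr_mk3 !mul_mk3 !simp.
by congr mk3; rewrite ?expr2 ?addrr_pchar2.
Qed.

Lemma shear_orbit q :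
  sconj_orbit setT (involution_pair 0) (involution_pair (q ^+ 2)).
Proof.
exists (Sdp sigma (slconj hU (shear q)) false) => //.
(* Since [uni2 0] is 1, this reads g = x(q^2) sigma(g), with x(t) the corner image of [uni2 t]. *)
have E0 : (slconj hU (shear q) * slconj hU (sl_corner (uni2 0)) =
    slconj hU (sl_corner (uni2 (q ^+ 2))) * slconj hU (shear_inner q))%g.
  rewrite -!slconjM; congr slconj; apply/val_inj.
  by rewrite /= !corner_mk2 !mul_mk3; congr mk3; ring.
have E1 : (slconj hU (shear q) * slconj hU (sl_corner (uni2 1)) =
    slconj hU (sl_corner (uni2 1)) * slconj hU (shear q))%g.
  rewrite -!slconjM; congr slconj; apply/val_inj.
  by rewrite /= !corner_mk2 !mul_mk3; congr mk3; ring.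
rewrite /sconj /involution_pair; congr pair; apply: (canLR (mulgK _)).
  by congr Sdp; rewrite /= gaut_shear.
by congr Sdp.
Qed.

Lemma involution_pair_orbit_inj s t :
  sconj_orbit sl2_sdp (involution_pair s) =
  sconj_orbit sl2_sdp (involution_pair t) -> s = t.
Proof.
move=> E; have : sconj_orbit sl2_sdp (involution_pair t) (involution_pair t).
  exists 1%g; first by case: sl2_sdp_subgroup.
  by rewrite /sconj !mul1g invg1 !mulg1.
(* The factor sigma^b of the conjugating element cancels, leaving X in SL_2; the second coordinate
   says that X commutes with [uni2 1]. *)
rewrite -E => -[_ [X [b ->]]]; rewrite /sconj embV !embM => E12.
have [E1 _] := emb_inj (congr1 fst E12); have [E2 _] := emb_inj (congr1 snd E12).
have cX : (X * uni2 1 = uni2 1 * X)%g by rewrite -[in RHS]E2 mulgKV.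
by apply: uni2_inj; rewrite -E1 (commute_uni2 s cX) mulgK.
Qed.

End CornerSubgroup.

(** * Splitting of the G-orbit into M-classes *)

Theorem theorem8p1 (k : closedFieldType) (char2 : 2%N \in [pchar k])
    (sigma : graph_aut k) (sigma_nontrivial : exists A, sigma A <> A) :
  exists (M : set (SL3_sdp sigma)) (m1 m2 : SL3_sdp sigma),
    [/\ reductive (sdp_regular sigma) M,
        ~ zconnected (sdp_regular sigma) M,
        M m1, M m2
      & exists C : set (set (SL3_sdp sigma * SL3_sdp sigma)),
          [/\ infinite_set C,
              C `<=` [set sconj_orbit M p | p in M `*` M]
            & sconj_orbit setT (m1, m2) `&` (M `*` M)
              = \bigcup_(c in C) c]].
Proof.
have [h [hU form]] := gaut_form sigma_nontrivial char2.
pose H : set (SL3_sdp sigma) := sl2_sdp hU.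
pose O := sconj_orbit setT (involution_pair sigma hU 0) `&` (H `*` H).
have pair_H t : (H `*` H) (involution_pair sigma hU t) by split; do 2 eexists.
have [H1 HM HV] := sl2_sdp_subgroup char2 form.
exists H, (involution_pair sigma hU 0).1, (involution_pair sigma hU 0).2; split.
- exact: sl2_sdp_reductive.
- exact: sl2_sdp_not_connected.
- by have [] := pair_H 0.
- by have [] := pair_H 0.
(* The intersection is stable under M, so it is the union of the M-orbits of its points. *)
exists [set sconj_orbit H p | p in O]; split.
- move=> finC; apply: (@closed_field_infinite k).
  (* The parameter is q^2 because [shear_orbit] only reaches squares; squaring is injective, so [f]
     is too, and every q lies in the preimage of the family. *)
  pose f q := sconj_orbit H (involution_pair sigma hU (q ^+ 2)).
  have := finite_preimage (f := f) _ finC; rewrite (_ : _ @^-1` _ = setT).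
    apply=> s t _ _ /(involution_pair_orbit_inj char2 form).
    exact: sqr_inj_char2.
  rewrite eqEsubset; split=> // q _.
  exists (involution_pair sigma hU (q ^+ 2)) => //.
  by split; [exact: shear_orbit | exact: pair_H].
- by move=> _ [p [_ Hp] <-]; exists p.
rewrite -/O eqEsubset; split=> [p Op|p [_ [q [[g _ gq] [Hq1 Hq2]] <-] [x Hx <-]]].
  exists (sconj_orbit H p); first by exists p.
  by exists 1%g => //; case: p {Op} => p1 p2; rewrite /sconj !mul1g invg1 !mulg1.
split.
  exists (x * g)%g => //; rewrite -gq /sconj /=.
  by rewrite !invMg !mulgA.
by split; apply: (HM) => //; try apply: HV => //; apply: HM.
Qed.
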